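(* Let $E\in\mathbb R^{k\times N}$ be a nonzero matrix, $A\in\mathbb R^{m\times N}$, $y\in\mathbb R^m$, $C\in\mathbb R^{p\times N}$, $d\in\mathbb R^p$, and let $f:\mathbb R^m\to\mathbb R$ be a $C^1$ strictly convex function. Suppose the problem $$\min_{x\in\mathbb R^N} f(Ax-y)+\|Ex\|_1\quad\text{subject to}\quad Cx\ge d$$ has an optimal solution, let $x^*\in\mathbb R^N$ be a feasible point of it, and let $\alpha$, $\mathcal S$, $b$ be as defined in the context. Then $x^*$ is the unique minimizer of this problem if and only if the following conditions hold: (a) the matrix $\begin{bmatrix}A\\ C_{\alpha\bullet}\\ E_{\mathcal S^c\bullet}\end{bmatrix}$ has full column rank; (b) there exist $u\in\mathbb R^m$, $u'\in\mathbb R^{|\alpha|}_{++}$, and $u''\in\mathbb R^{|\mathcal S^c|}$ with $\|u''\|_\infty<1$ such that $A^Tu+C_{\alpha\bullet}^Tu'-E_{\mathcal S^c\bullet}^Tu''=b$; (c) there exist $\widetilde u\in\mathbb R^{|\alpha|}_+$ and $\widetilde u'\in\mathbb R^{|\mathcal S^c|}$ with $\|\widetilde u'\|_\infty\le1$ such that $A^T\nabla f(Ax^*-y)-C_{\alpha\bullet}^T\widetilde u+b+E_{\mathcal S^c\bullet}^T\widetilde u'=0$.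
   Context: Vector inequalities are componentwise; $\mathbb R^n_+$ and $\mathbb R^n_{++}$ are the nonnegative and (strictly) positive orthants. For a matrix $M$ and row index set $\beta$, $M_{\beta\bullet}$ is the submatrix of rows indexed by $\beta$. Given $x^*$: $\alpha:=\{i\in\{1,\ldots,p\}\mid(Cx^*-d)_i=0\}$; $\mathcal S:=\{i\in\{1,\ldots,k\}\mid(Ex^* )_i\ne0\}$ with complement $\mathcal S^c$ in $\{1,\ldots,k\}$; $\widehat b:=\mathrm{sgn}((Ex^* )_{\mathcal S})\in\{\pm1\}^{|\mathcal S|}$ (componentwise sign) and $b:=E_{\mathcal S\bullet}^T\widehat b\in\mathbb R^N$ (so $b=0$ if $\mathcal S=\emptyset$). *)

(* Defs.v *)
From HB Require Import structures.
From mathcomp Require Import all_boot all_order all_algebra.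
From mathcomp Require Import classical_sets reals topology normedtype derive.

Set Implicit Arguments.
Unset Strict Implicit.
Unset Printing Implicit Defensive.

Import Order.TTheory GRing.Theory Num.Theory.
Import numFieldNormedType.Exports.

Local Open Scope ring_scope.

(* M_{B•}: the rows of M with index in B, in increasing order of the index. *)
Definition rows_in (T : Type) (m n : nat) (M : 'M[T]_(m, n)) (B : {set 'I_m}) :
  'M[T]_(#|B|, n) := rowsub (fun i : 'I_#|B| => enum_val i) M.

(* The max norm is the library norm `|v| on 'cV[R]_n (mx_norm). *)
Definition l1norm (R : realType) (n : nat) (v : 'cV[R]_n) : R :=
  \sum_i `|v i 0|.

Definition gradient (R : realType) (m : nat) (f : 'cV[R]_m -> R)
  (z : 'cV[R]_m) : 'cV[R]_m := \col_i 'D_(delta_mx i 0) f z.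

(* In finite dimension, continuity of the differential amounts to continuity
   of its coordinates, i.e. of the gradient. *)
Definition is_C1 (R : realType) (m : nat) (f : 'cV[R]_m -> R) : Prop :=
  (forall z, differentiable f z) /\ continuous (gradient f).

Definition strictly_convex (R : realType) (m : nat) (f : 'cV[R]_m -> R) : Prop :=
  forall (z w : 'cV[R]_m) (t : R), z <> w -> 0 < t < 1 ->
    f (t *: z + (1 - t) *: w) < t * f z + (1 - t) * f w.

Definition feasible (R : realType) (p N : nat) (C : 'M[R]_(p, N))
  (d : 'cV[R]_p) : set 'cV[R]_N :=
  fun x => forall i, d i 0 <= (C *m x) i 0.

Definition objective (R : realType) (k N m : nat) (f : 'cV[R]_m -> R)
  (A : 'M[R]_(m, N)) (y : 'cV[R]_m) (E : 'M[R]_(k, N)) (x : 'cV[R]_N) : R :=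
  f (A *m x - y) + l1norm (E *m x).

Definition is_minimizer (R : realType) (T : Type) (g : T -> R) (D : set T)
  (x : T) : Prop := D x /\ forall x', D x' -> g x <= g x'.

Definition is_unique_minimizer (R : realType) (T : Type) (g : T -> R)
  (D : set T) (x : T) : Prop :=
  is_minimizer g D x /\ forall x', is_minimizer g D x' -> x' = x.

Definition active_set (R : realType) (p N : nat) (C : 'M[R]_(p, N))
  (d : 'cV[R]_p) (x : 'cV[R]_N) : {set 'I_p} :=
  [set i | (C *m x - d) i 0 == 0]%SET.

Definition support_set (R : realType) (k N : nat) (E : 'M[R]_(k, N))
  (x : 'cV[R]_N) : {set 'I_k} :=
  [set i | (E *m x) i 0 != 0]%SET.

Definition sign_vector (R : realType) (k N : nat) (E : 'M[R]_(k, N))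
  (x : 'cV[R]_N) : 'cV[R]_(#|support_set E x|) :=
  map_mx Num.sg (rows_in (E *m x) (support_set E x)).

Definition b_vector (R : realType) (k N : nat) (E : 'M[R]_(k, N))
  (x : 'cV[R]_N) : 'cV[R]_N :=
  (rows_in E (support_set E x))^T *m sign_vector E x.

(* Main.v *)
(* Write [phi h = b^T h + ||E_{S^c} h||_1] for the one-sided directional
   derivative of [x |-> ||E x||_1] at [x*]; it is exact for small steps and a
   lower bound for all steps.  Hence [x*] is a minimizer iff
   [g^T A h + phi h >= 0] for all [h] with [C_alpha h >= 0], where [g] is the
   gradient of [f] at [A x* - y], which by Farkas' lemma is (c).  By strict
   convexity all minimizers have the same image under [A], so a minimizer [x*]
   is unique iff [phi h > 0] for all nonzero [h] with [A h = 0] and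
   [C_alpha h >= 0].  Injectivity of the stacked matrix and strict multipliers
   clearly suffice for this; conversely, [phi] is odd on the kernel of that
   matrix, and (b) comes from one more application of Farkas' lemma. *)
Require Import Defs.
From HB Require Import structures.
From mathcomp Require Import all_boot all_order all_algebra.
From mathcomp Require Import lra.
From mathcomp Require Import boolp classical_sets reals topology normedtype derive.

Set Implicit Arguments.
Unset Strict Implicit.
Unset Printing Implicit Defensive.

Import Order.TTheory GRing.Theory Num.Theory.
Import numFieldNormedType.Exports.

Local Open Scope classical_set_scope.
Local Open Scope ring_scope.

(** * Farkas' lemma and the existence of multipliers *)

(** Induction on the number of rows. If the rows below the first row [a] do not already force
    [c *m x] to be nonnegative, a counterexample [x0] gives a projection onto the kernel of [a],
    where the induction hypothesis applies. *)
Lemma farkas (F : realFieldType) (q n : nat) (M : 'M[F]_(q, n)) (c : 'rV[F]_n) :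
  (forall x : 'cV_n, (forall i, 0 <= (M *m x) i 0) -> 0 <= (c *m x) 0 0) ->
  exists2 l : 'rV_q, (forall i, 0 <= l 0 i) & c = l *m M.
Proof.
elim: q M c => [|q IHq] M c Mc.
  exists 0 => [[]//|]; rewrite mul0mx; apply/rowP => j; rewrite mxE.
  have cj (x : 'cV_n) : 0 <= (c *m x) 0 0 by apply: Mc => -[].
  have:= cj (delta_mx j 0); have:= cj (- delta_mx j 0).
  rewrite mulmxN -colE !mxE oppr_ge0 => le0 ge0.
  by apply/eqP; rewrite eq_le le0.
rewrite -[M](@vsubmxK _ 1 q) in Mc *.
move: (usubmx _) (dsubmx _) Mc => a M' Mc {M}.
have {}Mc (x : 'cV_n) : (forall i, 0 <= (col_mx (a *m x) (M' *m x)) i 0) ->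
    0 <= (c *m x) 0 0.
  by move=> Mx; apply: Mc => i; rewrite (@mul_col_mx _ 1 q).
have [M'c|] := pselect (forall x : 'cV_n,
    (forall i, 0 <= (M' *m x) i 0) -> 0 <= (c *m x) 0 0).
  have [l l_ge0 ->] := IHq M' c M'c.
  exists (row_mx (0 : 'rV_1) l) => [i|]; last first.
    by rewrite (@mul_row_col _ _ 1 q) mul0mx add0r.
  by rewrite mxE; case: split_ordP => j _; rewrite ?mxE.
move/existsNP => [x0 /not_implyP[M'x0 /negP]]; rewrite -ltNge => cx0.
have ax0 : (a *m x0) 0 0 < 0.
  rewrite ltNge; apply/negP => ax0_ge0; move: cx0; rewrite ltNge => /negP[].
  apply: Mc => i; rewrite mxE.
  by case: split_ordP => j _; [rewrite ord1|exact: M'x0].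
(* Scaling so that [a *m x0 = -1] makes [1%:M + x0 *m a] the projection onto the kernel of [a] along
   [x0]. *)
have {x0 M'x0 cx0 ax0} [x0 [M'x0 cx0 ax0]] : exists x0 : 'cV_n,
    [/\ forall i, 0 <= (M' *m x0) i 0, (c *m x0) 0 0 < 0 & a *m x0 = (- 1)%:M].
  exists ((- ((a *m x0) 0 0)^-1) *: x0).
  have k_gt0 : 0 < - ((a *m x0) 0 0)^-1 by rewrite oppr_gt0 invr_lt0.
  split=> [i||].
  - by rewrite -scalemxAr mxE mulr_ge0// ltW.
  - by rewrite -scalemxAr mxE pmulr_rlt0.
  - rewrite -scalemxAr; move: (a *m x0) ax0 {k_gt0} => k k_lt0.
    apply/matrixP => i j; rewrite !ord1 !mxE eqxx.
    by rewrite mulNr mulVf// lt_eqF.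
have proj_ge0 (x : 'cV_n) : (forall i, 0 <= (M' *m (1%:M + x0 *m a) *m x) i 0) ->
    0 <= (c *m (1%:M + x0 *m a) *m x) 0 0.
  rewrite -!mulmxA => Mx; apply: Mc => i; rewrite mxE.
  case: split_ordP => j _; last exact: Mx.
  rewrite mulmxA mulmxDr mulmx1 mulmxA ax0 mul_scalar_mx scaleN1r subrr.
  by rewrite mul0mx mxE.
have [l l_ge0 /eqP] := IHq _ _ proj_ge0.
rewrite mulmxDr mulmx1 -subr_eq0 => /eqP cE.
(* Expanding the projected identity leaves this coefficient in front of [a]; it is nonnegative
   because [M' *m x0 >= 0] and [c *m x0 < 0]. *)
exists (row_mx (l *m M' *m x0 - c *m x0) l) => [i|].
  rewrite mxE; case: split_ordP => j _ //.
  rewrite ord1 mxE [X in _ + X]mxE subr_ge0 (le_trans (ltW cx0))// -mulmxA mxE.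
  by apply: sumr_ge0 => k _; rewrite mulr_ge0.
apply/eqP; rewrite (@mul_row_col _ _ 1 q) -subr_eq0 -cE; apply/eqP.
by rewrite mulmxBl !mulmxDr mulmx1 !mulmxA opprD opprB
  [X in _ = _ - X]addrC opprD !addrA.
Qed.

(* A bound [|E x| <= s] is the pair of linear constraints [- E x + s >= 0]
   and [E x + s >= 0], whose multipliers [p], [r] give [w = r - p]. *)
Lemma farkas_norm (F : realFieldType) (q e n : nat) (C : 'M[F]_(q, n))
    (D : 'M[F]_(q, e)) (E : 'M[F]_(e, n)) (c : 'rV[F]_n) (mu : 'rV[F]_e) :
  (forall (x : 'cV_n) (s : 'cV_e),
    (forall i, 0 <= (C *m x + D *m s) i 0) ->
    (forall i, `|(E *m x) i 0| <= s i 0) -> 0 <= (c *m x + mu *m s) 0 0) ->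
  exists (v : 'rV_q) (w : 'rV_e),
    [/\ forall i, 0 <= v 0 i, forall i, `|w 0 i| <= (mu - v *m D) 0 i &
        c = v *m C + w *m E].
Proof.
move=> cmu; pose M := col_mx (row_mx C D)
  (col_mx (row_mx (- E) 1%:M) (row_mx E 1%:M)).
have [z|l l_ge0] := @farkas F _ _ M (row_mx c mu).
  rewrite -[z]vsubmxK !mul_col_mx !mul_row_col !mul1mx mulNmx => z_ge0.
  apply: cmu => i.
    by have := z_ge0 (lshift _ i); rewrite col_mxEu.
  have := z_ge0 (rshift _ (rshift _ i)); have := z_ge0 (rshift _ (lshift _ i)).
  rewrite !(col_mxEd, col_mxEu) 2!mxE [X in _ -> is_true (_ <= X) -> _]mxE.
  by rewrite addrC subr_ge0 -lerBlDr sub0r ler_norml => -> ->.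
rewrite -[l]hsubmxK -[rsubmx l]hsubmxK; set v := lsubmx l.
set p := lsubmx _; set r := rsubmx _.
rewrite !mul_row_col !mul_mx_row !add_row_mx !mulmx1 => /eq_row_mx[cE muE].
have v_ge0 i : 0 <= v 0 i by rewrite mxE.
have p_ge0 i : 0 <= p 0 i by rewrite !mxE.
have r_ge0 i : 0 <= r 0 i by rewrite !mxE.
exists v, (r - p); split=> // [i|]; last first.
  by rewrite cE mulmxBl mulmxN [- _ + _]addrC.
(* The bound [mu - v *m D] equals [p + r], which dominates [|r - p|] for nonnegative [p] and [r]. *)
rewrite muE [_ + (p + r)]addrC addrK [leRHS]mxE mxE [X in `|_ + X|]mxE.
by rewrite ler_norml; have := p_ge0 i; have := r_ge0 i; lra.
Qed.

(** The norm is the least sum of the entries of [s] under [|E x| <= s], so [farkas_norm] applies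
    with [D = 0]; the unit weights of [s] become the bound on [w]. *)
Lemma stationarity_multipliers (R : realType) (q e n : nat) (C : 'M[R]_(q, n))
    (E : 'M[R]_(e, n)) (g : 'rV[R]_n) :
  (forall x : 'cV_n, (forall i, 0 <= (C *m x) i 0) ->
    0 <= (g *m x) 0 0 + l1norm (E *m x)) ->
  exists (v : 'rV_q) (w : 'rV_e),
    [/\ forall i, 0 <= v 0 i, forall i, `|w 0 i| <= 1 & g = v *m C + w *m E].
Proof.
move=> gC; have [x s|v [w [v_ge0 w_le1 gE]]] :=
  @farkas_norm R q e n C 0 E g (const_mx 1).
  rewrite mul0mx addr0 => Cx Es; rewrite mxE (le_trans (gC x Cx))// lerD2l mxE.
  by apply: ler_sum => i _; rewrite [X in X * _]mxE mul1r.
exists v, w; split=> // i.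
by have := w_le1 i; rewrite mulmx0 subr0 mxE.
Qed.

(* The hypothesis makes [x = 0] and [s = 0] the only solution of the system
   [A x = 0], [C x >= 0], [b x + sum s <= 0], [|E x| <= s], which therefore
   implies [b x - sum (C x) - sum s >= 0]; the coefficients [-1] of this
   consequence are what makes the multipliers strict. *)
Lemma strict_multipliers (R : realType) (m q e n : nat) (A : 'M[R]_(m, n))
    (C : 'M[R]_(q, n)) (E : 'M[R]_(e, n)) (b : 'rV[R]_n) :
  (forall x : 'cV_n, A *m x = 0 -> (forall i, 0 <= (C *m x) i 0) ->
    (b *m x) 0 0 + l1norm (E *m x) <= 0 -> x = 0) ->
  exists (u : 'rV_m) (v : 'rV_q) (w : 'rV_e),
    [/\ forall i, 0 < v 0 i, forall i, `|w 0 i| < 1 &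
        b = u *m A + v *m C + w *m E].
Proof.
move=> sharp.
pose C' := col_mx A (col_mx (- A) (col_mx C (- b))).
pose D' : 'M[R]_(m + (m + (q + 1)), e) :=
  col_mx 0 (col_mx 0 (col_mx 0 (const_mx (-1)))).
have [x s|l [w [l_ge0 w_le bE]]] :=
  @farkas_norm R _ e n C' D' E (b - const_mx 1 *m C) (const_mx (-1)).
  rewrite !mul_col_mx !add_col_mx !mul0mx !addr0 !mulNmx => ge0 Es.
  have Ax : A *m x = 0.
    apply/colP => i; apply/eqP; rewrite [X in _ == X]mxE eq_le.
    have := ge0 (lshift _ i); rewrite col_mxEu => ->.
    have := ge0 (rshift _ (lshift _ i)).
    by rewrite col_mxEd col_mxEu mxE oppr_ge0 => ->.
  have Cx i : 0 <= (C *m x) i 0.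
    have := ge0 (rshift _ (rshift _ (lshift _ i))).
    by rewrite !(col_mxEd, col_mxEu).
  have bx : (b *m x) 0 0 + \sum_i s i 0 <= 0.
    have := ge0 (rshift _ (rshift _ (rshift _ 0))).
    rewrite !(col_mxEd, col_mxEu) [X in 0 <= X -> _]mxE [X in 0 <= X + _ -> _]mxE.
    rewrite [X in 0 <= _ + X -> _]mxE; under eq_bigr do rewrite mxE mulN1r.
    by rewrite sumrN; lra.
  have Es_sum : l1norm (E *m x) <= \sum_i s i 0 by apply: ler_sum.
  have x0 : x = 0 by apply: sharp => //; lra.
  move: bx; rewrite x0 !mulmx0 !add0r !mxE add0r => s_le0.
  by under eq_bigr do rewrite mxE mulN1r; rewrite sumrN oppr_ge0.
move: bE w_le; rewrite -[l]hsubmxK -[rsubmx l]hsubmxK.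
rewrite -[rsubmx (rsubmx l)]hsubmxK.
set u1 := lsubmx l; set u2 := lsubmx _; set v := lsubmx _; set k := rsubmx _.
rewrite !mul_row_col !mulmx0 !add0r => bE w_le.
have v_ge0 i : 0 <= v 0 i by rewrite !mxE.
have k_ge0 : 0 <= k 0 0 by rewrite !mxE.
have k1_gt0 : 0 < 1 + k 0 0 by rewrite ltr_pwDl.
have {}w_le i : `|w 0 i| <= k 0 0 - 1.
  have := w_le i; rewrite [X in _ <= X -> _]mxE [X in _ <= X + _ -> _]mxE.
  rewrite [X in _ <= _ + X -> _]mxE [X in _ <= _ - X -> _]mxE big_ord1.
  by rewrite [X in _ * X]mxE mulrN1 opprK addrC.
(* [k] is the multiplier of the row [- b x - sum s >= 0]; its term [- k b] is moved to the side of
   [b]. *)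
have {}bE : (1 + k 0 0) *: b =
    (u1 - u2) *m A + (v + const_mx 1) *m C + w *m E.
  rewrite scalerDl scale1r -mul_scalar_mx -mx11_scalar.
  move: bE; rewrite mulmxBl mulmxDl !mulmxN.
  move: (u1 *m A) (u2 *m A) (v *m C) (k *m b) (w *m E) (const_mx 1 *m C).
  move=> a1 a2 c1 kb e1 c2 /rowP bE; apply/rowP => j.
  by have := bE j; rewrite !mxE; lra.
(* After division by [1 + k], the entries of [v + 1] stay positive, and those of [w] are bounded by
   [(k - 1) / (k + 1) < 1]. *)
exists ((1 + k 0 0)^-1 *: (u1 - u2)), ((1 + k 0 0)^-1 *: (v + const_mx 1)),
  ((1 + k 0 0)^-1 *: w); split=> [i|i|].
- by rewrite mxE mulr_gt0 ?invr_gt0// mxE [X in _ + X]mxE ltr_wpDl.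
- rewrite mxE normrM gtr0_norm ?invr_gt0// mulrC ltr_pdivrMr// mul1r.
  by apply: le_lt_trans (w_le i) _; lra.
by rewrite -!scalemxAl -!scalerDr -bE scalerA mulVf ?scale1r// gt_eqF.
Qed.

(** * One-sided slopes of the l1 norm, and feasible directions *)

Lemma near_affine_ge0 (R : realType) (a c : R) : 0 < a ->
  \forall t \near 0^'+, 0 <= a + t * c.
Proof.
move=> a_gt0; have c1_gt0 : 0 < `|c| + 1 by rewrite ltr_wpDl.
near=> t; have t_gt0 : 0 < t by near: t; exact: nbhs_right_gt.
have ta : t * (`|c| + 1) <= a.
  rewrite -ler_pdivlMr//; near: t; apply: nbhs_right_le.
  exact: divr_gt0.
have : t * - c <= t * (`|c| + 1).
  by rewrite ler_pM2l// (le_trans (ler_norm _))// normrN lerDl.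
lra.
Unshelve. all: by end_near. Qed.

(** The right derivative of [t |-> |a + t c|] at 0. *)
Definition norm_slope (R : realType) (a c : R) : R :=
  if a != 0 then Num.sg a * c else `|c|.

(** For [a != 0] the left side is [sg a * (a + c)], which is at most its absolute value. *)
Lemma norm_slope_le (R : realType) (a c : R) :
  `|a| + norm_slope a c <= `|a + c|.
Proof.
rewrite /norm_slope; case: eqVneq => [->|a_neq0]; first by rewrite normr0 !add0r.
rewrite normrEsg -mulrDr (le_trans (ler_norm _))// normrM normr_sg a_neq0.
by rewrite mul1r.
Qed.

(** A small step does not change the sign of a nonzero [a], so the absolute value is linear
    there. *)
Lemma norm_slope_near (R : realType) (a c : R) :
  \forall t \near 0^'+, `|a + t * c| = `|a| + t * norm_slope a c.
Proof.
rewrite /norm_slope; case: eqVneq => [->|a_neq0].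
  near=> t; have t_gt0 : 0 < t by near: t; exact: nbhs_right_gt.
  by rewrite normr0 !add0r normrM gtr0_norm.
near=> t.
have : 0 <= `|a| + t * (Num.sg a * c).
  by near: t; apply: near_affine_ge0; rewrite normr_gt0.
have -> : `|a| + t * (Num.sg a * c) = Num.sg a * (a + t * c).
  by rewrite normrEsg mulrDr mulrCA.
by move=> /ger0_norm <-; rewrite normrM normr_sg a_neq0 mul1r.
Unshelve. all: by end_near. Qed.

Lemma rows_in_mulmx (R : realType) (q n : nat) (M : 'M[R]_(q, n))
    (B : {set 'I_q}) (x : 'cV[R]_n) i :
  (rows_in M B *m x) i 0 = (M *m x) (enum_val i) 0.
Proof. by rewrite mul_rowsub_mx mxE. Qed.

(** The function [phi] of the overview, based at [x]. *)
Definition l1slope (R : realType) (k n : nat) (E : 'M[R]_(k, n))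
  (x h : 'cV[R]_n) : R :=
  ((b_vector E x)^T *m h) 0 0 +
  l1norm (rows_in E (~: support_set E x)%SET *m h).

(** Coordinates in the support contribute the linear term in [b_vector], the others the norm; this
    reduces both slope estimates to scalar ones. *)
Lemma l1slopeE (R : realType) (k n : nat) (E : 'M[R]_(k, n)) (x h : 'cV[R]_n) :
  l1slope E x h = \sum_i norm_slope ((E *m x) i 0) ((E *m h) i 0).
Proof.
rewrite (bigID [in support_set E x])/=; congr (_ + _).
  rewrite /b_vector trmx_mul trmxK -mulmxA mxE.
  rewrite [RHS]big_enum_val; apply: eq_bigr => j _.
  rewrite rows_in_mulmx /norm_slope.
  by have := enum_valP j; rewrite inE => ->; rewrite mxE /sign_vector mxE /rows_in mxE.
rewrite (eq_bigl [in (~: support_set E x)%SET]) => [|i]; last by rewrite !inE.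
rewrite [RHS]big_enum_val; apply: eq_bigr => j _.
rewrite rows_in_mulmx /norm_slope.
by have := enum_valP j; rewrite !inE => /negPf ->.
Qed.

Lemma l1slope_le (R : realType) (k n : nat) (E : 'M[R]_(k, n)) (x h : 'cV[R]_n) :
  l1norm (E *m x) + l1slope E x h <= l1norm (E *m (x + h)).
Proof.
rewrite l1slopeE -big_split; apply: ler_sum => i _.
by rewrite mulmxDr [X in _ <= `|X|]mxE norm_slope_le.
Qed.

Lemma l1slope_near (R : realType) (k n : nat) (E : 'M[R]_(k, n)) (x h : 'cV[R]_n) :
  \forall t \near 0^'+,
    l1norm (E *m (x + t *: h)) = l1norm (E *m x) + t * l1slope E x h.
Proof.
near=> t; rewrite l1slopeE mulr_sumr -big_split; apply: eq_bigr => i _ /=.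
rewrite mulmxDr -scalemxAr mxE [X in _ + X]mxE.
by move: i; near: t; apply: filter_forall => i; exact: norm_slope_near.
Unshelve. all: by end_near. Qed.

(** Active constraints do not decrease along [h], and each of the finitely many inactive ones has
    positive slack, which survives small steps. *)
Lemma feasible_near (R : realType) (p n : nat) (C : 'M[R]_(p, n))
    (d : 'cV[R]_p) (x h : 'cV[R]_n) :
  feasible C d x ->
  (forall i, 0 <= (rows_in C (active_set C d x) *m h) i 0) ->
  \forall t \near 0^'+, feasible C d (x + t *: h).
Proof.
move=> x_feas h_act; apply: filter_forall => i.
have := x_feas i; rewrite le_eqVlt => /predU1P[di|di].
  have act_i : i \in active_set C d x by rewrite inE !mxE subr_eq0 di mxE.
  have := h_act (enum_rank_in act_i i).
  rewrite rows_in_mulmx enum_rankK_in// => Chi.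
  near=> t; have t_gt0 : 0 < t by near: t; exact: nbhs_right_gt.
  by rewrite mulmxDr -scalemxAr mxE [X in _ + X]mxE di lerDl mulr_ge0// ltW.
near=> t; rewrite mulmxDr -scalemxAr mxE [X in _ + X]mxE -subr_ge0 addrAC.
by near: t; apply: near_affine_ge0; rewrite subr_gt0.
Unshelve. all: by end_near. Qed.

Lemma feasible_active (R : realType) (p n : nat) (C : 'M[R]_(p, n))
    (d : 'cV[R]_p) (x x' : 'cV[R]_n) : feasible C d x' ->
  forall i, 0 <= (rows_in C (active_set C d x) *m (x' - x)) i 0.
Proof.
move=> x'_feas i; rewrite rows_in_mulmx mulmxBr mxE [X in _ + X]mxE subr_ge0.
have := enum_valP i; rewrite inE mxE [X in _ + X]mxE subr_eq0 => /eqP ->.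
exact: x'_feas.
Qed.

(** * Directional derivatives and the gradient inequality *)

(** Since the derivative exists, it is the limit of the difference quotients from the right
    alone. *)
Lemma derive_ge (R : realType) (V : normedModType R) (f : V -> R) (z v : V) a :
  derivable f z v -> (\forall t \near 0^'+, f z + t * a <= f (z + t *: v)) ->
  a <= 'D_v f z.
Proof.
move=> df ge_a; rewrite /derive normed_module.cvg_at_rightE//.
apply: limr_ge.
  by apply/cvg_ex; exists ('D_v f z); exact: cvg_dnbhs_at_right.
near=> t; have t_gt0 : 0 < t by near: t; exact: nbhs_right_gt.
rewrite /= /GRing.scale/= ler_pdivlMl// lerBrDl [_ + z]addrC.
by near: t; exact: ge_a.
Unshelve. all: by end_near. Qed.

Lemma derive_le (R : realType) (V : normedModType R) (f : V -> R) (z v : V) a :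
  derivable f z v -> (\forall t \near 0^'+, f (z + t *: v) <= f z + t * a) ->
  'D_v f z <= a.
Proof.
move=> df le_a; rewrite -lerN2 -deriveN//; apply: derive_ge.
  exact: derivableN.
by near=> t; rewrite /= mulrN -opprD lerN2; near: t.
Unshelve. all: by end_near. Qed.

Lemma derive_gradient (R : realType) (m : nat) (f : 'cV[R]_m -> R)
    (z v : 'cV[R]_m) : differentiable f z ->
  'D_v f z = ((gradient f z)^T *m v) 0 0.
Proof.
move=> df; rewrite deriveE// [in LHS](matrix_sum_delta v) linear_sum mxE.
apply: eq_bigr => i _.
by rewrite big_ord1 linearZ/= mulrC !mxE deriveE.
Qed.

Lemma strictly_convex_midpoint (R : realType) (m : nat) (f : 'cV[R]_m -> R)
    (z w : 'cV[R]_m) : strictly_convex f -> z <> w ->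
  f (2^-1 *: (z + w)) < 2^-1 * (f z + f w).
Proof.
move=> /(_ z w 2^-1) f_convex zw; have := f_convex zw.
have -> : 1 - 2^-1 = 2^-1 :> R by lra.
by rewrite -scalerDr -mulrDr; apply; lra.
Qed.

(** By convexity the difference quotients from [z] towards [w] are at most [f w - f z]; the
    derivative inherits the bound. *)
Lemma convex_gradient (R : realType) (m : nat) (f : 'cV[R]_m -> R)
    (z w : 'cV[R]_m) : strictly_convex f -> differentiable f z ->
  f z + ((gradient f z)^T *m (w - z)) 0 0 <= f w.
Proof.
move=> f_convex df; rewrite -derive_gradient// addrC -lerBrDr.
apply: derive_le; first exact: diff_derivable.
(* Strict convexity speaks only of distinct points. *)
have [->|/eqP wz] := eqVneq w z.
  by near=> t; rewrite !subrr scaler0 mulr0 !addr0.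
near=> t; have -> : z + t *: (w - z) = t *: w + (1 - t) *: z.
  by rewrite scalerBr scalerBl scale1r addrCA.
have -> : f z + t * (f w - f z) = t * f w + (1 - t) * f z by lra.
apply/ltW/f_convex => //; apply/andP; split.
  by near: t; exact: nbhs_right_gt.
by near: t; exact: nbhs_right_lt.
Unshelve. all: by end_near. Qed.

(** The sign condition on [e] matters for the empty column, whose norm is 0 while the entrywise
    condition is void. *)
Lemma normr_cV_le (R : realType) (n : nat) (v : 'cV[R]_n) (e : R) : 0 <= e ->
  reflect (forall i, `|v i 0| <= e) (`|v| <= e).
Proof.
move=> e_ge0; rewrite [`|v|]mx_normrE; apply: (iffP (bigmax_leP _ _ _ _)) =>
  [[_ le_e] i|le_e].
  exact: (le_e (i, 0)).
by split=> // -[i j] _ /=; rewrite ord1.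
Qed.

Lemma normr_cV_lt (R : realType) (n : nat) (v : 'cV[R]_n) (e : R) : 0 < e ->
  reflect (forall i, `|v i 0| < e) (`|v| < e).
Proof.
move=> e_gt0; rewrite [`|v|]mx_normrE; apply: (iffP (bigmax_ltP _ _ _ _)) =>
  [[_ lt_e] i|lt_e].
  exact: (lt_e (i, 0)).
by split=> // -[i j] _ /=; rewrite ord1.
Qed.

(** * Optimality and uniqueness in terms of directions *)

Section Optimality.
Context (R : realType) (k N m p : nat) (E : 'M[R]_(k, N)) (A : 'M[R]_(m, N)).
Context (y : 'cV[R]_m) (C : 'M[R]_(p, N)) (d : 'cV[R]_p) (f : 'cV[R]_m -> R).
Context (f_diff : forall z, differentiable f z) (f_convex : strictly_convex f).
Context (xs : 'cV[R]_N) (xs_feasible : feasible C d xs).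

Local Notation Ca := (rows_in C (active_set C d xs)).
Local Notation ESc := (rows_in E (~: support_set E xs)%SET).
Local Notation g := (gradient f (A *m xs - y)).

(** Small feasible steps bound the derivative of [f] along [A *m h] below by minus the slope.
    Conversely, the gradient inequality and [l1slope_le] hold for full steps and add up. *)
Lemma minimizerP : is_minimizer (objective f A y E) (feasible C d) xs <->
  forall h, (forall i, 0 <= (Ca *m h) i 0) ->
    0 <= (g^T *m A *m h) 0 0 + l1slope E xs h.
Proof.
split=> [[_ xs_min] h Cah|ge0].
  rewrite -mulmxA -derive_gradient// addrC -[l1slope _ _ _]opprK addrC subr_ge0.
  apply: derive_ge; first exact: diff_derivable.
  have h_near := l1slope_near E xs h.
  have hf_near := feasible_near xs_feasible Cah.
  near=> t; have := xs_min (xs + t *: h).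
  have l1E : l1norm (E *m (xs + t *: h)) =
      l1norm (E *m xs) + t * l1slope E xs h by near: t.
  rewrite /objective l1E mulmxDr -scalemxAr addrAC => /(_ _)-h_le.
  have : feasible C d (xs + t *: h) by near: t.
  by move=> /h_le; lra.
split=> // x' x'_feas; have := ge0 _ (feasible_active x'_feas).
have := l1slope_le E xs (x' - xs); rewrite [xs + _]addrC subrK.
have := convex_gradient (A *m x' - y) f_convex (f_diff (A *m xs - y)).
rewrite opprB addrA subrK -mulmxBr mulmxA /objective; lra.
Unshelve. all: by end_near. Qed.

Lemma unique_minimizerP :
  is_minimizer (objective f A y E) (feasible C d) xs ->
  is_unique_minimizer (objective f A y E) (feasible C d) xs <->
  forall h, A *m h = 0 -> (forall i, 0 <= (Ca *m h) i 0) ->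
    l1slope E xs h <= 0 -> h = 0.
Proof.
move=> xs_min; split=> [[_ xs_uniq] h Ah Cah slope_le0|sharp].
  have h_near := l1slope_near E xs h.
  have hf_near := feasible_near xs_feasible Cah.
  (* As [A *m h = 0], a small step along [h] changes the objective only by [t] times a nonpositive
     slope, so it reaches another minimizer unless it is zero. *)
  have : \forall t \near 0^'+, t *: h = 0.
    near=> t; have t_gt0 : 0 < t by near: t; exact: nbhs_right_gt.
    have xt_feas : feasible C d (xs + t *: h) by near: t.
    apply: (addrI xs); rewrite addr0; apply: xs_uniq; split=> // x' x'_feas.
    apply: le_trans (xs_min.2 x' x'_feas).
    have l1E : l1norm (E *m (xs + t *: h)) =
        l1norm (E *m xs) + t * l1slope E xs h by near: t.
    rewrite /objective l1E mulmxDr -scalemxAr Ah scaler0 addr0.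
    by rewrite lerD2l gerDl pmulr_rle0.
  move=> th0; have [t [th]] : exists t, t *: h = 0 /\ 0 < t.
    apply: (@filter_ex _ (0 : R)^'+); near=> t.
    by split; near: t => //; exact: nbhs_right_gt.
  move: th => /eqP; rewrite scaler_eq0 => /orP[/eqP ->|/eqP //].
  by rewrite ltxx.
split=> // x' [x'_feas x'_min].
have obj_eq : objective f A y E x' = objective f A y E xs.
  by apply/eqP; rewrite eq_le x'_min ?xs_min.2//; case: xs_min.
(* Otherwise the midpoint, which is feasible, would have a strictly smaller objective. *)
have Ax' : A *m x' = A *m xs.
  apply/eqP/negPn/negP => /eqP Ax'.
  have zw : A *m x' - y <> A *m xs - y by move/addIr.
  have := strictly_convex_midpoint f_convex zw.
  have mid_feas : feasible C d (2^-1 *: (x' + xs)).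
    move=> i; rewrite -scalemxAr mulmxDr mxE [X in _ * X]mxE.
    by have := x'_feas i; have := xs_feasible i; lra.
  have := xs_min.2 _ mid_feas; rewrite -obj_eq.
  have := obj_eq; rewrite /objective.
  have -> : A *m (2^-1 *: (x' + xs)) - y =
      2^-1 *: (A *m x' - y + (A *m xs - y)).
    rewrite -scalemxAr mulmxDr addrACA [RHS]scalerDr -opprD scalerN -mulr2n.
    by rewrite -[y *+ 2]scaler_nat scalerA mulVf ?scale1r ?pnatr_eq0.
  have : l1norm (E *m (2^-1 *: (x' + xs))) <=
      2^-1 * (l1norm (E *m x') + l1norm (E *m xs)).
    rewrite -big_split mulr_sumr; apply: ler_sum => i _ /=.
    rewrite -scalemxAr mulmxDr mxE normrM gtr0_norm ?invr_gt0//.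
    by rewrite ler_pM2l ?invr_gt0// mxE ler_normD.
  lra.
apply/eqP; rewrite -subr_eq0; apply/eqP/sharp.
- by rewrite mulmxBr Ax' subrr.
- exact: feasible_active.
(* Equal objectives and equal images under [A] give equal l1 norms, so the slope towards [x'] is at
   most 0. *)
have := l1slope_le E xs (x' - xs); rewrite [xs + _]addrC subrK.
by move: obj_eq; rewrite /objective Ax'; lra.
Unshelve. all: by end_near. Qed.

End Optimality.

(** * Full column rank, and equality cases for multipliers *)

Lemma rank_eq_ncolsP (F : fieldType) (q n : nat) (M : 'M[F]_(q, n)) :
  \rank M = n <-> forall x : 'cV_n, M *m x = 0 -> x = 0.
Proof.
split=> [/eqP M_full x Mx|M_inj].
  by apply: (row_full_inj M_full); rewrite Mx mulmx0.
rewrite -mxrank_tr; apply/eqP; rewrite -/(row_free M^T) -kermx_eq0.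
apply/eqP/row_matrixP => i; rewrite row0.
apply: trmx_inj; rewrite trmx0; apply: M_inj.
by rewrite -[LHS]trmxK trmx_mul trmxK -row_mul mulmx_ker row0 trmx0.
Qed.

Lemma mulmx_ge0 (R : realType) (n : nat) (u : 'rV[R]_n) (v : 'cV[R]_n) :
  (forall i, 0 <= u 0 i) -> (forall i, 0 <= v i 0) -> 0 <= (u *m v) 0 0.
Proof. by move=> u0 v0; rewrite mxE; apply: sumr_ge0 => i _; rewrite mulr_ge0. Qed.

Lemma mulmx_gt0_eq0 (R : realType) (n : nat) (u : 'rV[R]_n) (v : 'cV[R]_n) :
  (forall i, 0 < u 0 i) -> (forall i, 0 <= v i 0) -> (u *m v) 0 0 <= 0 -> v = 0.
Proof.
move=> u_gt0 v_ge0; rewrite mxE => uv_le0; apply/colP => i; rewrite [RHS]mxE.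
have uv_ge0 j : true -> 0 <= u 0 j * v j 0 by rewrite mulr_ge0// ltW.
have /eqP : \sum_j u 0 j * v j 0 = 0 by apply/eqP; rewrite eq_le uv_le0 sumr_ge0.
rewrite psumr_eq0// => /allP/(_ i); rewrite mem_index_enum => /(_ isT).
by rewrite mulf_eq0 gt_eqF//= => /eqP.
Qed.

Lemma mulmx_le_l1norm (R : realType) (n : nat) (w : 'rV[R]_n) (z : 'cV[R]_n) :
  (forall i, `|w 0 i| <= 1) -> (w *m z) 0 0 <= l1norm z.
Proof.
move=> w_le1; rewrite mxE; apply: ler_sum => i _.
by rewrite (le_trans (ler_norm _))// normrM ler_piMl.
Qed.

(** The sum of [(1 - |w_i|) |z_i|] is then nonpositive although its weights are positive, so every
    [|z_i|] vanishes. *)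
Lemma l1norm_le_mulmx_eq0 (R : realType) (n : nat) (w : 'rV[R]_n) (z : 'cV[R]_n) :
  (forall i, `|w 0 i| < 1) -> l1norm z <= (w *m z) 0 0 -> z = 0.
Proof.
move=> w_lt1 z_le; have : map_mx Num.norm z = 0.
  apply: (@mulmx_gt0_eq0 _ _ (\row_i (1 - `|w 0 i|))) => [i|i|].
  - by rewrite mxE subr_gt0.
  - by rewrite mxE.
  rewrite mxE; under eq_bigr do rewrite 2!mxE mulrBl mul1r -normrM.
  rewrite sumrB subr_le0 (le_trans z_le)// mxE; apply: ler_sum => i _.
  exact: ler_norm.
move=> /colP z0; apply/colP => i; have := z0 i; rewrite !mxE => /eqP.
by rewrite normr_eq0 => /eqP.
Qed.

Theorem proposition4p2 (R : realType) (k N m p : nat)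
  (E : 'M[R]_(k, N)) (A : 'M[R]_(m, N)) (y : 'cV[R]_m)
  (C : 'M[R]_(p, N)) (d : 'cV[R]_p) (f : 'cV[R]_m -> R) (xs : 'cV[R]_N)
  (E_neq0 : E <> 0) (f_C1 : is_C1 f) (f_convex : strictly_convex f)
  (has_opt : exists x0 : 'cV[R]_N,
     is_minimizer (objective f A y E) (feasible C d) x0)
  (xs_feasible : feasible C d xs) :
  let alpha := active_set C d xs in
  let S := support_set E xs in
  let Ca := rows_in C alpha in
  let ESc := rows_in E (~: S)%SET in
  let b := b_vector E xs in
  is_unique_minimizer (objective f A y E) (feasible C d) xs <->
  [/\ \rank (col_mx A (col_mx Ca ESc)) = N,
      exists (u : 'cV[R]_m) (u' : 'cV[R]_(#|alpha|))
             (u'' : 'cV[R]_(#|(~: S)%SET|)),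
        [/\ forall i, 0 < u' i 0,
            `|u''| < 1 &
            A^T *m u + Ca^T *m u' - ESc^T *m u'' = b] &
      exists (v : 'cV[R]_(#|alpha|)) (v' : 'cV[R]_(#|(~: S)%SET|)),
        [/\ forall i, 0 <= v i 0,
            `|v'| <= 1 &
            A^T *m gradient f (A *m xs - y) - Ca^T *m v + b + ESc^T *m v' = 0]].
Proof.
move=> alpha S Ca ESc b; have f_diff := f_C1.1.
split=> [xs_uniq|[/rank_eq_ncolsP full [u [u' [u'' [u'_gt0 u''_lt1 bE]]]]
                  [v [v' [v_ge0 v'_le1 gE]]]]].
  have xs_min := xs_uniq.1.
  have sharp := (unique_minimizerP f_convex xs_feasible xs_min).1 xs_uniq.
  have stat := (minimizerP E A y f_diff f_convex xs_feasible).1 xs_min.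
  split.
  - apply/rank_eq_ncolsP => x; rewrite !mul_col_mx => /eqP.
    rewrite !col_mx_eq0 => /and3P[/eqP Ax /eqP Cax /eqP Ex].
    (* On the kernel the slope is the linear form [b^T *m x], so it is nonpositive at [x] or at
       [- x], and [sharp] applies to that vector. *)
    have : 0 <= - (b^T *m x) 0 0 \/ 0 <= (b^T *m x) 0 0.
      by have [] := leP 0 ((b^T *m x) 0 0); [right|left; rewrite oppr_ge0 ltW].
    rewrite /l1slope -/b -/S -/ESc in sharp; case=> bx.
      apply: sharp => // [i|]; first by rewrite Cax mxE.
      by rewrite Ex -oppr_ge0 /l1norm big1 ?addr0// => i _; rewrite mxE normr0.
    apply/eqP; rewrite -oppr_eq0; apply/eqP; apply: sharp => // [|i|].
    + by rewrite mulmxN Ax oppr0.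
    + by rewrite mulmxN Cax oppr0 mxE.
    rewrite !mulmxN Ex oppr0 /l1norm big1 => [|i _]; last by rewrite mxE normr0.
    by rewrite addr0 mxE oppr_le0.
  - have [u [v [w [v_gt0 w_lt1 bE]]]] := strict_multipliers sharp.
    (* The minus sign matches the subtracted term of (b). *)
    exists u^T, v^T, (- w^T); split=> [i||]; first by rewrite mxE.
      by apply/normr_cV_lt => // i; rewrite 2!mxE normrN.
    by rewrite mulmxN opprK -!trmx_mul -!linearD -bE/= trmxK.
  have [x Cax|v [w [v_ge0 w_le1 gE]]] := @stationarity_multipliers _ _ _ _ Ca ESc
    ((gradient f (A *m xs - y))^T *m A + b^T).
    by have := stat x Cax; rewrite /l1slope addrA mulmxDl [X in _ -> _ <= X + _]mxE.
  exists v^T, (- w^T); split=> [i||]; first by rewrite mxE.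
    by apply/normr_cV_le => // i; rewrite 2!mxE normrN.
  have gTE : A^T *m gradient f (A *m xs - y) + b = Ca^T *m v^T + ESc^T *m w^T.
    by rewrite -!trmx_mul -linearD -gE linearD/= trmx_mul !trmxK.
  by rewrite mulmxN [X in X - _]addrAC gTE -addrA -opprD subrr.
have bTE : b^T = u^T *m A + u'^T *m Ca - u''^T *m ESc.
  by rewrite -bE !linearB !linearD/= !trmx_mul !trmxK.
have xs_min : is_minimizer (objective f A y E) (feasible C d) xs.
  apply/minimizerP => // h Cah.
  have -> : (gradient f (A *m xs - y))^T *m A = v^T *m Ca - v'^T *m ESc - b^T.
    rewrite -[LHS]trmxK trmx_mul trmxK.
    have -> : A^T *m gradient f (A *m xs - y) = Ca^T *m v - ESc^T *m v' - b.
      move: gE; move: (A^T *m _) (Ca^T *m _) (ESc^T *m _) => a c e /colP gE.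
      by apply/colP => i; have := gE i; rewrite !mxE; lra.
    by rewrite !linearB/= !trmx_mul !trmxK.
  have entryB (a1 a2 a3 : 'M[R]_1) :
      (a1 - a2 - a3) 0 0 = a1 0 0 - a2 0 0 - a3 0 0 by rewrite !mxE.
  (* The [b] terms of (c) and of the slope cancel, leaving [v C h] and [||E h||_1 - v' E h], both
     nonnegative. *)
  rewrite /l1slope !mulmxBl entryB addrA subrK.
  have ge0 : 0 <= (v^T *m Ca *m h) 0 0.
    by rewrite -mulmxA; apply: mulmx_ge0 => // i; rewrite mxE.
  have : (v'^T *m ESc *m h) 0 0 <= l1norm (ESc *m h).
    rewrite -mulmxA; apply: mulmx_le_l1norm => i; rewrite mxE.
    by move/normr_cV_le : v'_le1; exact.
  by rewrite -/ESc; lra.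
apply/unique_minimizerP => // h Ah Cah slope_le0; apply: full.
have bhE : (b^T *m h) 0 0 = (u'^T *m (Ca *m h)) 0 0 - (u''^T *m (ESc *m h)) 0 0.
  rewrite bTE mulmxBl mulmxDl -!mulmxA Ah mulmx0 add0r.
  by rewrite mxE [X in _ + X]mxE.
have u'_gt0T i : 0 < u'^T 0 i by rewrite mxE.
have u''_lt1T i : `|u''^T 0 i| < 1.
  by rewrite mxE; move/normr_cV_lt : u''_lt1; exact.
have Ca_ge0 : 0 <= (u'^T *m (Ca *m h)) 0 0.
  by apply: mulmx_ge0 => // i; exact: ltW.
(* The slope is now [u' C h] plus [||E h||_1 - u'' E h]. Both parts are nonnegative with nonpositive
   sum, so both vanish, and strictness of the multipliers forces [C h = 0] and [E h = 0] on the
   selected rows. *)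
have := mulmx_le_l1norm (ESc *m h) (fun i => ltW (u''_lt1T i)).
move: slope_le0; rewrite /l1slope -/ESc -/b bhE => slope_le0 ESc_ge0.
have ESh : ESc *m h = 0 by apply: (l1norm_le_mulmx_eq0 u''_lt1T); lra.
have Cah0 : Ca *m h = 0 by apply: (mulmx_gt0_eq0 u'_gt0T) => //; lra.
by rewrite !mul_col_mx Ah Cah0 ESh !col_mx0.
Qed.
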